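(* There exists $c>0$, and for every $\varepsilon>0$ there exists $c_1>0$, such that the following holds for every sufficiently large $n$. Let $G$ be a $d$-regular graph on $n$ vertices with $d\geq 1$, and let $\lambda_2$ denote the second largest eigenvalue of the adjacency matrix of $G$. Then $$\lambda_2>\begin{cases} c\,d^{1/2} &\text{if } d\leq n^{2/3},\\ c\, n/d & \text{if } n^{2/3}\leq d\leq n^{3/4},\\ c_1\,d^{1/3} & \text{if } n^{3/4}\leq d\leq (1/2-\varepsilon)n.\end{cases}$$ *)

(* Defs.v *)
From HB Require Import structures.
From mathcomp Require Import all_boot all_order all_algebra complex.
From mathcomp Require Import all_classical all_reals all_analysis.

Set Implicit Arguments.
Unset Strict Implicit.
Unset Printing Implicit Defensive.

Import Order.TTheory GRing.Theory Num.Theory.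
Local Open Scope ring_scope.

Record sgraph (V : finType) := SGraph {
  adj :> rel V;
  adj_sym : symmetric adj;
  adj_irr : irreflexive adj }.

Definition regular (V : finType) (G : sgraph V) (d : nat) : Prop :=
  forall v : V, #|[set w | G v w]| = d.

Definition adjmx (R : realType) (V : finType) (G : sgraph V) : 'M[R]_#|V| :=
  \matrix_(i, j) (G (enum_val i) (enum_val j))%:R.

(* The eigenvalues listed in nonincreasing order, repeated according to their
   multiplicity in the characteristic polynomial. The list is unique when it
   exists, and it exists for every symmetric matrix (eigenvaluesP below); the
   default value [::] is only reached when char_poly A does not split over R. *)
Definition eigenvalues (R : realType) (n : nat) (A : 'M[R]_n) : seq R :=
  xget [::] [set s : seq R |
    sorted >=%R s /\ char_poly A = \prod_(x <- s) ('X - x%:P)]%classic.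

Definition lambda2 (R : realType) (V : finType) (G : sgraph V) : R :=
  nth 0 (eigenvalues (adjmx R G)) 1.

Lemma char_poly_conj (F : fieldType) (n : nat) (P A : 'M[F]_n) :
  P \in unitmx -> char_poly (invmx P *m A *m P) = char_poly A.
Proof.
move=> uP; rewrite /char_poly.
have -> : char_poly_mx (invmx P *m A *m P) =
  map_mx polyC (invmx P) *m char_poly_mx A *m map_mx polyC P.
  rewrite /char_poly_mx mulmxBr mulmxBl !map_mxM; congr (_ - _).
  rewrite mul_mx_scalar -scalemxAl -map_mxM mulVmx // map_scalar_mx.
  by rewrite scale_scalar_mx mulr1.
rewrite !det_mulmx mulrAC -det_mulmx -map_mxM mulVmx // map_scalar_mx.
by rewrite det1 mul1r.
Qed.

Lemma char_poly_splits (R : realType) (n : nat) (A : 'M[R]_n) :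
  A^T = A -> exists s : seq R, char_poly A = \prod_(x <- s) ('X - x%:P).
Proof.
move=> symA; pose B := map_mx (real_complex R) A.
have hB : B \is hermsymmx.
  apply: realsym_hermsym.
    apply/is_hermitianmxP.
    by rewrite expr0 scale1r map_mx_id // /B map_trmx symA.
  by apply/mxOverP => i j; rewrite mxE complex_real.
have /orthomx_spectralP EB := hermitian_normalmx hB.
have /mxOverP hr := hermitian_spectral_diag_real hB.
pose D := spectral_diag B.
have cB : char_poly B = \prod_i ('X - (D 0 i)%:P).
  rewrite EB char_poly_conj ?spectral_unit //.
  rewrite char_poly_trig; last exact: diag_mx_is_trig.
  by apply: eq_bigr => i _; rewrite mxE eqxx mulr1n.
exists [seq complex.Re (D 0 i) | i <- enum 'I_n].
apply: (@map_poly_inj _ _ (real_complex R)).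
rewrite map_char_poly cB big_map rmorph_prod big_enum /=.
apply: eq_bigr => i _; rewrite rmorphB /= map_polyX map_polyC /=.
by rewrite RRe_real ?hr.
Qed.

Lemma eigenvaluesP (R : realType) (n : nat) (A : 'M[R]_n) : A^T = A ->
  sorted >=%R (eigenvalues A) /\
  char_poly A = \prod_(x <- eigenvalues A) ('X - x%:P).
Proof.
move=> /char_poly_splits[s As].
apply: (@xgetPex _ [::] (fun s : seq R =>
  sorted >=%R s /\ char_poly A = \prod_(x <- s) ('X - x%:P))).
exists (sort >=%R s); split; first by apply: sort_sorted => x y; exact: le_total.
by rewrite As; apply: perm_big; rewrite perm_sym perm_sort.
Qed.

Lemma tr_adjmx (R : realType) (V : finType) (G : sgraph V) :
  (adjmx R G)^T = adjmx R G.
Proof. by apply/matrixP => i j; rewrite !mxE adj_sym. Qed.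

(* Main.v *)
Require Import Defs.
From HB Require Import structures.
From mathcomp Require Import all_boot all_order all_algebra all_fingroup complex.
From mathcomp Require Import all_classical all_reals all_analysis.
From mathcomp Require Import ring lra.

(** Suppose that lambda_2 <= lam < d and let M = lam I - A + ((d - lam) / n) J.
  The all-ones vector is an eigenvector of A for d, and every other eigenvalue
  is at most lam, so M is positive semidefinite. Two inequalities for positive
  semidefinite matrices give the three bounds. Cauchy-Schwarz for the
  eigenvalues, (tr M^2)^2 <= tr M tr M^3, together with tr A = 0, tr A^2 = nd
  and tr A^3 >= 0, yields
    (nd + n lam^2 - (d - lam)^2)^2
      <= (n lam + d - lam) (n lam^3 + 3 lam nd + (d - lam)^3),
  which fails when lam is a small multiple of min(d^(1/2), n/d) and
  d <= n^(3/4). By Schur's product theorem the entrywise cube of M is positive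
  semidefinite, so its entries have a nonnegative sum; with p = (d - lam) / n
  this forces (lam + p)^3 >= d (1 - p) (1 - 2 p), which is of order d when
  d <= (1/2 - eps) n. *)

Set Implicit Arguments.
Unset Strict Implicit.
Unset Printing Implicit Defensive.

Import Order.TTheory GRing.Theory Num.Theory.
Local Open Scope ring_scope.

(** * Power sums and unitary diagonalization *)

(** Lagrange's identity: twice the difference of the two sides is the sum of
    [x i * x j * (x i - x j) ^+ 2] over all pairs. *)
Lemma sum_sqr_le_sum_mul_sum_cube (R : realDomainType) (I : finType)
    (x : I -> R) : (forall i, 0 <= x i) ->
  (\sum_i x i ^+ 2) ^+ 2 <= (\sum_i x i) * (\sum_i x i ^+ 3).
Proof.
move=> x0; rewrite -(ler_pMn2r (isT : (0 < 2)%N)) -subr_ge0.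
have -> : (\sum_i x i) * (\sum_i x i ^+ 3) *+ 2 - (\sum_i x i ^+ 2) ^+ 2 *+ 2 =
    \sum_i \sum_j x i * x j * (x i - x j) ^+ 2.
  rewrite mulr2n {2}[(\sum_i x i) * _]mulrC expr2 !big_distrlr /=.
  rewrite -sumrMnl -big_split -sumrB /=.
  apply: eq_bigr => i _; rewrite -sumrMnl -big_split -sumrB /=.
  by apply: eq_bigr => j _; ring.
by do 2![apply: sumr_ge0 => ? _]; rewrite mulr_ge0 ?sqr_ge0 ?mulr_ge0.
Qed.

Section SpectralDecomposition.
Variables (C : numClosedFieldType) (n : nat) (P : 'M[C]_n).
Implicit Type mu : 'rV[C]_n.

(** For unitary [P] the conjugated rows of [P] are the eigenvectors. Keeping [P] fixed makes
    matrices with a common eigenbasis comparable through their spectra alone. *)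
Definition unitary_diag mu := map_mx Num.conj P^T *m diag_mx mu *m P.

Lemma unitary_diagE mu i j :
  unitary_diag mu i j = \sum_k mu 0 k * ((P k i)^* * P k j).
Proof.
rewrite mxE; apply: eq_bigr => k _; rewrite mul_mx_diag !mxE; ring.
Qed.

(* Expanding the cube over triples t of rows of P, the sum becomes a combination
   of squared moduli with the nonnegative coefficients mu_t1 mu_t2 mu_t3. *)
Lemma sum_cube_unitary_diag_ge0 mu : (forall k, 0 <= mu 0 k) ->
  0 <= \sum_i \sum_j unitary_diag mu i j ^+ 3.
Proof.
move=> mu0.
pose v (t : 'I_n * ('I_n * 'I_n)) i := P t.1 i * P t.2.1 i * P t.2.2 i.
pose m (t : 'I_n * ('I_n * 'I_n)) := mu 0 t.1 * mu 0 t.2.1 * mu 0 t.2.2.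
have -> : \sum_i \sum_j unitary_diag mu i j ^+ 3 =
    \sum_i \sum_j \sum_t m t * ((v t i)^* * v t j).
  apply: eq_bigr => i _; apply: eq_bigr => j _.
  rewrite unitary_diagE 2!exprS expr1 big_distrlr /= pair_big /=.
  rewrite big_distrlr /= pair_big /=; apply: eq_bigr => t _.
  rewrite /m /v !rmorphM /=; ring.
under eq_bigr do rewrite exchange_big /=.
rewrite exchange_big /=; apply: sumr_ge0 => t _.
suff -> : \sum_i \sum_j m t * ((v t i)^* * v t j) =
    m t * `|\sum_i v t i| ^+ 2.
  by rewrite mulr_ge0 ?exprn_ge0 // /m !mulr_ge0.
rewrite normCKC rmorph_sum big_distrlr /= big_distrr /=.
by apply: eq_bigr => i _; rewrite big_distrr.
Qed.

Hypothesis unitaryP : P \is unitarymx.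

Lemma mul_unitary_diag mu nu :
  unitary_diag mu *m unitary_diag nu =
  unitary_diag (\row_k (mu 0 k * nu 0 k)).
Proof.
rewrite /unitary_diag !mulmxA -[_ *m P *m _]mulmxA (unitarymxP unitaryP).
by rewrite mulmx1 -[_ *m diag_mx mu *m _]mulmxA mulmx_diag.
Qed.

Lemma mxtrace_unitary_diag mu : \tr (unitary_diag mu) = \sum_k mu 0 k.
Proof.
rewrite /unitary_diag mxtrace_mulC mulmxA (unitarymxP unitaryP) mul1mx.
by rewrite mxtrace_diag.
Qed.

Lemma unitary_diagK (B : 'M[C]_n) mu :
  P *m B *m map_mx Num.conj P^T = diag_mx mu -> B = unitary_diag mu.
Proof.
move=> PB; rewrite /unitary_diag -PB -invmx_unitary //.
by rewrite -!mulmxA mulVmx ?unitarymx_unit // mulmx1 !mulmxA mulVmx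
  ?unitarymx_unit // mul1mx.
Qed.

End SpectralDecomposition.

(** The eigenbasis lists the eigenvalues in no particular order. The permutation [s] sends each
    basis vector to a position in the sorted list, which is how [lambda2] is later located; it
    exists because a split polynomial determines its roots up to order. *)
Lemma symmetric_spectral (R : realType) (n : nat) (A : 'M[R]_n) : A^T = A ->
  exists (P : 'M[R[i]]_n) (r : 'I_n -> R) (s : {perm 'I_n}),
  [/\ P \is unitarymx,
      map_mx (real_complex R) A =
        unitary_diag P (\row_k real_complex R (r k)),
      size (eigenvalues A) = n
    & forall k, r k = nth 0 (eigenvalues A) (s k)].
Proof.
move=> symA; pose B := map_mx (real_complex R) A.
have hB : B \is hermsymmx.
  apply: realsym_hermsym.
    apply/is_hermitianmxP.
    by rewrite expr0 scale1r map_mx_id // /B map_trmx symA.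
  by apply/mxOverP => i j; rewrite mxE complex_real.
have /orthomx_spectralP EB := hermitian_normalmx hB.
have /mxOverP hr := hermitian_spectral_diag_real hB.
pose D := spectral_diag B.
pose r k := complex.Re (D 0 k).
have rD k : real_complex R (r k) = D 0 k by rewrite RRe_real ?hr.
have cA : char_poly A = \prod_(x <- [seq r i | i <- enum 'I_n]) ('X - x%:P).
  apply: (@map_poly_inj _ _ (real_complex R)).
  rewrite map_char_poly -/B EB char_poly_conj ?spectral_unit //.
  rewrite char_poly_trig; last exact: diag_mx_is_trig.
  rewrite big_map rmorph_prod big_enum /=.
  apply: eq_bigr => i _; rewrite mxE eqxx mulr1n rmorphB /= map_polyX map_polyC.
  by rewrite /= rD.
have [_ cE] := eigenvaluesP symA.
have prm : perm_eq [seq r i | i <- enum 'I_n] (eigenvalues A).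
  by apply: prod_XsubC_eq; rewrite -cA -cE.
have sz : size (eigenvalues A) = n.
  by rewrite -(perm_size prm) size_map size_enum_ord.
pose t := tcast sz (in_tuple (eigenvalues A)).
have tE : t = eigenvalues A :> seq R by rewrite val_tcast.
move: prm; rewrite -{1}tE => /tuple_permP[s sE].
exists (spectralmx B), r, s; split=> //.
- exact: spectral_unitarymx.
- rewrite -/B {1}EB invmx_unitary ?spectral_unitarymx // /unitary_diag.
  by congr (_ *m diag_mx _ *m _); apply/rowP => k; rewrite mxE rD.
- move=> k; rewrite -tE -(tnth_nth 0 t (s k)).
  have := congr1 (fun u => nth 0 u k) sE.
  rewrite (nth_map k) ?size_enum_ord // nth_ord_enum => ->.
  by rewrite (nth_map k) ?size_enum_ord // nth_ord_enum.
Qed.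

(** * The two spectral inequalities for regular graphs *)

Section RegularGraph.
Variables (R : realType) (V : finType) (G : sgraph V) (d : nat).
Hypothesis regG : regular G d.
Local Notation N := (#|V|%:R : R).
Local Notation D := (d%:R : R).
Local Notation A := (adjmx R G).
Local Notation toC := (real_complex R).

Lemma sum_adjmx_row i : \sum_j A i j = D.
Proof.
under eq_bigr do rewrite mxE.
rewrite -(regG (enum_val i)) -sum1_card natr_sum.
rewrite -(big_enum_val (fun v => (G (enum_val i) v)%:R : R)) /=.
rewrite [RHS]big_mkcond; apply: eq_bigr => v _.
by rewrite inE; case: (G _ v).
Qed.

Lemma mxtrace_adjmx : \tr A = 0.
Proof. by rewrite /mxtrace big1 // => i _; rewrite mxE adj_irr. Qed.

Lemma mxtrace_adjmx2 : \tr (A *m A) = N * D.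
Proof.
transitivity (\sum_(i < #|V|) D); last first.
  by rewrite sumr_const card_ord mulr_natl.
apply: eq_bigr => i _; rewrite -(sum_adjmx_row i) mxE; apply: eq_bigr => j _.
by rewrite !mxE [G (enum_val j) _]adj_sym -natrM mulnb andbb.
Qed.

Lemma mxtrace_adjmx3_ge0 : 0 <= \tr (A *m A *m A).
Proof.
apply: sumr_ge0 => i _; rewrite mxE; apply: sumr_ge0 => j _.
rewrite mulr_ge0 //; last by rewrite mxE.
by rewrite mxE; apply: sumr_ge0 => k _; rewrite !mxE -natrM.
Qed.

Variable lam : R.
Hypotheses (V_gt0 : (0 < #|V|)%N) (lambda2_le : lambda2 R G <= lam).
Hypothesis lam_lt : lam < D.

(* Every eigenvalue but one is at most lam < d, so the all-ones vector spans
   the eigenspace of d and the rank-one matrix J is diagonal in the same basis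
   as A. *)
Lemma regular_spectral :
  exists (P : 'M[R[i]]_#|V|) (r : 'I_#|V| -> R) (k0 : 'I_#|V|),
  [/\ P \is unitarymx,
      map_mx toC A = unitary_diag P (\row_k toC (r k)),
      const_mx 1 = unitary_diag P (\row_k toC (N *+ (k == k0))),
      r k0 = D
    & forall k, k != k0 -> r k <= lam].
Proof.
have [P [r [s [uP EA szE rE]]]] := symmetric_spectral (tr_adjmx R G).
have [srt _] := eigenvaluesP (tr_adjmx R G).
(* Since [1 <= s k < size], position 1 lies inside the list, so [lambda2] is a genuine eigenvalue
   and not the default of [nth]. *)
have r_le k : (0 < s k)%N -> r k <= lam.
  move=> sk; apply: le_trans lambda2_le; rewrite rE /lambda2.
  have ge_trans : transitive (>=%R : rel R) by move=> x y z xy /le_trans; apply.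
  have szs : (s k < size (eigenvalues A))%N by rewrite szE.
  apply: (sorted_leq_nth ge_trans (fun=> lexx _) _ srt) => //.
  by rewrite inE; exact: leq_ltn_trans szs.
pose u : 'cV[R[i]]_#|V| := const_mx 1.
have [w wE] : exists w, w = P *m u by exists (P *m u).
have Au : map_mx toC A *m u = toC D *: u.
  apply/colP => i; rewrite !mxE mulr1 -(sum_adjmx_row i) rmorph_sum.
  by apply: eq_bigr => j _; rewrite !mxE mulr1.
(* [w] holds the coordinates of the all-ones vector in the eigenbasis; it can only have weight on
   eigenvectors for [D]. *)
have w_eig k : w k 0 != 0 -> r k = D.
  move=> wk; have: (diag_mx (\row_k toC (r k)) *m w) k 0 = (toC D *: w) k 0.
    congr ((_ : 'cV__) _ _); rewrite wE scalemxAr -Au EA /unitary_diag !mulmxA.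
    by rewrite (unitarymxP uP) mul1mx.
  by rewrite mul_diag_mx !mxE => /(mulIf wk)/(fmorph_inj toC).
have [k0 wk0] : exists k, w k 0 != 0.
  apply: contrapT => /forallNP w0.
  have : w = 0 by apply/colP => k; rewrite [RHS]mxE; apply/eqP/negPn/negP/w0.
  move/(congr1 (mulmx (invmx P))); rewrite wE mulKmx ?unitarymx_unit // mulmx0.
  move/colP/(_ (Ordinal V_gt0)); rewrite !mxE => /eqP.
  by rewrite oner_eq0.
(* As [lam < D], only the top position can carry the eigenvalue [D]; by injectivity of [s], [w] is
   supported at [k0] alone. *)
have sk0 : s k0 = 0 :> nat.
  apply/eqP; rewrite -leqn0 leqNgt; apply/negP => /r_le.
  by rewrite w_eig // leNgt lam_lt.
have s_gt0 k : k != k0 -> (0 < s k)%N.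
  rewrite lt0n; apply: contra => /eqP sk; apply/eqP/(@perm_inj _ s)/val_inj.
  by rewrite /= sk sk0.
have w0 k : k != k0 -> w k 0 = 0.
  move=> /s_gt0/r_le; have [//|/w_eig->] := eqVneq (w k 0) 0.
  by rewrite leNgt lam_lt.
exists P, r, k0; split=> // [||k /s_gt0/r_le //]; last exact: w_eig.
have uu : const_mx 1 = u *m map_mx Num.conj u^T.
  by apply/matrixP => i j; rewrite !mxE big_ord1 !mxE conjC1 mulr1.
pose x := w k0 0 * (w k0 0)^*.
have PJ : P *m const_mx 1 *m map_mx Num.conj P^T =
    diag_mx (\row_k (x *+ (k == k0))).
  have -> : P *m const_mx 1 *m map_mx Num.conj P^T =
      w *m map_mx Num.conj w^T.
    by rewrite uu wE trmx_mul map_mxM !mulmxA.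
  apply/matrixP => i j; rewrite !mxE big_ord1 !mxE.
  have [->|ik] := eqVneq i k0; last by rewrite w0 // mul0r mulr0n mul0rn.
  have [->|jk] := eqVneq j k0; first by rewrite !mulr1n.
  by rewrite (w0 j) // conjC0 mulr0 mulr0n.
(* Both sides of [PJ] have the same trace, and the trace of J is the number of vertices. *)
have xN : x = toC N.
  have := congr1 mxtrace PJ.
  rewrite mxtrace_mulC mulmxA -invmx_unitary // mulVmx ?unitarymx_unit //.
  rewrite mul1mx mxtrace_diag /mxtrace (bigD1 k0) //= [in RHS](bigD1 k0) //=.
  rewrite [X in _ = _ + X]big1; last by move=> k /negPf kk; rewrite mxE kk.
  rewrite !mxE eqxx mulr1n addr0 => <-.
  have -> : 1 + \sum_(i | i != k0) const_mx 1 i i =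
     \sum_(i < #|V|) (1 : R[i]).
    by rewrite [RHS](bigD1 k0) //=; congr (_ + _); apply: eq_bigr => i _;
      rewrite mxE.
  by rewrite sumr_const card_ord rmorph_nat.
rewrite (unitary_diagK uP PJ); congr unitary_diag; apply/rowP => k.
by rewrite !mxE xN; case: (k == k0).
Qed.

Lemma regular_trace_ineq :
  (N * D + N * lam ^+ 2 - (D - lam) ^+ 2) ^+ 2 <=
  (N * lam + D - lam) * (N * lam ^+ 3 + 3 * lam * (N * D) + (D - lam) ^+ 3).
Proof.
have [P [r [k0 [uP EA _ rk0 r_le]]]] := regular_spectral.
have S1 : \sum_k r k = 0.
  apply: (fmorph_inj toC); rewrite rmorph_sum rmorph0 -[RHS](rmorph0 toC).
  rewrite -mxtrace_adjmx -trace_map_mx EA mxtrace_unitary_diag //.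
  by apply: eq_bigr => k _; rewrite mxE.
have S2 : \sum_k r k ^+ 2 = N * D.
  apply: (fmorph_inj toC); rewrite rmorph_sum -mxtrace_adjmx2 -trace_map_mx map_mxM EA.
  rewrite mul_unitary_diag // mxtrace_unitary_diag //.
  by apply: eq_bigr => k _; rewrite !mxE rmorphXn expr2.
have S3 : 0 <= \sum_k r k ^+ 3.
  suff -> : \sum_k r k ^+ 3 = \tr (A *m A *m A) by exact: mxtrace_adjmx3_ge0.
  apply: (fmorph_inj toC); rewrite rmorph_sum -trace_map_mx !map_mxM EA.
  rewrite !mul_unitary_diag // mxtrace_unitary_diag //.
  by apply: eq_bigr => k _; rewrite !mxE rmorphXn !exprSr expr0 mul1r.
(* The spectrum of M: the J term lifts the eigenvalue [lam - D] at [k0] to 0. *)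
pose mu k := if k == k0 then 0 else lam - r k.
have mu_ge0 k : 0 <= mu k.
  by rewrite /mu; case: eqVneq => // /r_le; rewrite subr_ge0.
have Smu m : \sum_k mu k ^+ m.+1 = \sum_k (lam - r k) ^+ m.+1 - (lam - D) ^+ m.+1.
  rewrite (bigD1 k0) //= [in RHS](bigD1 k0) //= rk0 /mu eqxx expr0n /=.
  rewrite addrC addr0 addrAC subrr add0r.
  by apply: eq_bigr => k /negPf->.
have cst (a : R) : \sum_(k < #|V|) a = N * a.
  by rewrite sumr_const card_ord mulr_natl.
have M1 : \sum_k mu k = N * lam + D - lam.
  have := Smu 0; under eq_bigr do rewrite expr1.
  by move=> ->; rewrite sumrB S1 cst !expr1; ring.
have M2 : \sum_k mu k ^+ 2 = N * D + N * lam ^+ 2 - (D - lam) ^+ 2.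
  rewrite Smu (eq_bigr (fun k => lam ^+ 2 - 2 * lam * r k + r k ^+ 2));
    last by move=> k _; ring.
  by rewrite big_split sumrB /= cst -big_distrr /= S1 S2; ring.
(* Only a bound, because the sum of the [r k ^+ 3] is known only to be nonnegative; it enters with a
   minus sign. *)
have M3 : \sum_k mu k ^+ 3 <=
    N * lam ^+ 3 + 3 * lam * (N * D) + (D - lam) ^+ 3.
  rewrite Smu (eq_bigr (fun k => lam ^+ 3 - 3 * lam ^+ 2 * r k +
    3 * lam * r k ^+ 2 - r k ^+ 3)); last by move=> k _; ring.
  rewrite sumrB big_split sumrB /= cst -!big_distrr /= S1 S2.
  rewrite -subr_ge0; apply: le_trans S3 _; rewrite le_eqVlt; apply/orP; left.
  by apply/eqP; ring.
rewrite -M1 -M2; apply: le_trans (sum_sqr_le_sum_mul_sum_cube mu_ge0) _.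
by rewrite ler_wpM2l ?sumr_ge0.
Qed.

(** All rows of the entrywise cube of M have the same sum: M has [lam + p] on the diagonal, [p - 1]
    at the d neighbours and [p] elsewhere. So the total has the sign of a single row sum. *)
Lemma regular_cube_ineq (p := (D - lam) / N) :
  0 <= (lam + p) ^+ 3 - D * (1 - p) ^+ 3 + (N - D - 1) * p ^+ 3.
Proof.
have [P [r [k0 [uP EA EJ rk0 r_le]]]] := regular_spectral.
have N0 : N != 0 by rewrite pnatr_eq0 -lt0n.
pose mu k := lam - r k + (D - lam) *+ (k == k0).
have mu_ge0 k : 0 <= mu k.
  rewrite /mu; have [->|/r_le] := eqVneq k k0.
    by rewrite rk0 mulr1n -[lam - D]opprB addNr.
  by rewrite mulr0n addr0 subr_ge0.
pose M i j := lam *+ (i == j) - A i j + p.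
(* I, A and J are diagonal in the same basis, so their coefficients combine termwise; at [k0] this
   uses [p * N = D - lam]. *)
have EM i j : toC (M i j) = unitary_diag P (\row_k toC (mu k)) i j.
  have I1 : (1%:M : 'M[R[i]]_#|V|) = unitary_diag P (const_mx 1).
    rewrite /unitary_diag diag_const_mx mulmx1 -invmx_unitary //.
    by rewrite mulVmx ?unitarymx_unit.
  have /matrixP/(_ i j) := I1; have /matrixP/(_ i j) := EA.
  have /matrixP/(_ i j) := EJ; rewrite !unitary_diagE [LHS]mxE => J2.
  rewrite [LHS]mxE => A2; rewrite [LHS]mxE.
  under eq_bigr do rewrite mxE mul1r.
  move=> I2.
  rewrite /M rmorphD rmorphB /= A2 rmorphMn -mulr_natr I2 -[toC p]mulr1 J2.
  rewrite !big_distrr -sumrB -big_split /=; apply: eq_bigr => k _.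
  rewrite !mxE /mu rmorphD rmorphB /=.
  have [_|_] := eqVneq k k0; last by rewrite !mulr0n !rmorph0; ring.
  have pN : toC p * toC N = toC (D - lam) by rewrite -rmorphM /p divfK.
  by rewrite !mulr1n -pN; ring.
have : 0 <= \sum_i \sum_j M i j ^+ 3.
  rewrite -lecR rmorph0 rmorph_sum; under eq_bigr do rewrite rmorph_sum.
  under eq_bigr do under eq_bigr do rewrite rmorphXn /= EM.
  apply: sum_cube_unitary_diag_ge0 => k.
  by rewrite mxE (_ : 0 = toC 0) // lecR.
have row i : \sum_j M i j ^+ 3 =
    (lam + p) ^+ 3 - D * (1 - p) ^+ 3 + (N - D - 1) * p ^+ 3.
  rewrite (eq_bigr (fun j => p ^+ 3 + A i j * ((p - 1) ^+ 3 - p ^+ 3) +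
      ((lam + p) ^+ 3 - p ^+ 3) *+ (j == i))); last first.
    move=> j _; rewrite /M mxE [j == i]eq_sym.
    have [->|_] := eqVneq i j; first by rewrite adj_irr /= !mulr1n !mulr0n; ring.
    by case: (G _ _); rewrite /= ?mulr1n !mulr0n; ring.
  rewrite !big_split /= sumr_const card_ord -mulr_suml sum_adjmx_row.
  rewrite (bigD1 i) //= eqxx big1; last by move=> j /negPf->.
  by rewrite mulr1n -[p ^+ 3 *+ _]mulr_natl; ring.
under eq_bigr do rewrite row.
by rewrite sumr_const card_ord pmulrn_lge0.
Qed.

End RegularGraph.

(** * Numerical bounds from the two inequalities *)

(** If the bound failed, the trace inequality would have left side at least 81/100 of [(N * D) ^+ 2]
    and right side at most 3/5 of it. *)
Lemma sparse_lambda2_gt (R : realType) (V : finType) (G : sgraph V) (d : nat)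
    (lam : R) : 10 ^+ 4 <= #|V|%:R :> R -> (1 <= d)%N -> regular G d ->
  0 <= lam -> lam ^+ 2 <= d%:R / 100 -> lam * d%:R <= #|V|%:R / 10 ->
  d%:R ^+ 4 <= #|V|%:R ^+ 3 :> R -> lam < lambda2 R G.
Proof.
move=> N4 d1 regG lam0 lam2 lamd d4; rewrite ltNge; apply/negP => l2.
have D1 : 1 <= d%:R :> R by rewrite ler1n.
have lamD : lam < d%:R by nra.
have V0 : (0 < #|V|)%N.
  by rewrite -(ltr0n R); apply: lt_le_trans N4; rewrite exprn_gt0.
have := regular_trace_ineq regG V0 l2 lamD.
move: (#|V|%:R : R) (d%:R : R) N4 lam0 lam2 lamd d4 D1 lamD => N D.
move=> N4 lam0 lam2 lamd d4 D1 lamD.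
have N0 : 0 < N by apply: lt_le_trans N4; rewrite exprn_gt0.
(* From [D ^+ 4 <= N ^+ 3] and [10 ^+ 4 <= N]. *)
have DN : D <= N / 10.
  rewrite -(@ler_pXn2r _ 4) ?nnegrE //; [|lra|lra].
  apply: le_trans d4 _; rewrite expr_div_n (exprSr N 3) -mulrA ler_peMr //.
    by rewrite exprn_ge0 // ltW.
  by rewrite ler_pdivlMr ?mul1r // exprn_gt0.
have N1 : 1 <= N by lra.
move=> {N4 d4}; apply/negP; rewrite -ltNge.
have L : 9 / 10 * (N * D) <= N * D + N * lam ^+ 2 - (D - lam) ^+ 2.
  have h1 : D * D <= N / 10 * D by rewrite ler_wpM2r //; lra.
  have h2 : 0 <= lam * D by rewrite mulr_ge0 //; lra.
  have h3 : 0 <= (N - 1) * lam ^+ 2 by rewrite mulr_ge0 ?sqr_ge0 //; lra.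
  lra.
have U1 : N * lam + D - lam <= N * lam + D by lra.
have U2 : N * lam ^+ 3 + 3 * lam * (N * D) + (D - lam) ^+ 3 <=
    4 * (N * lam * D) + D ^+ 3.
  have h1 : N * lam * lam ^+ 2 <= N * lam * D.
    by rewrite ler_wpM2l ?mulr_ge0 //; lra.
  have h2 : (D - lam) ^+ 3 <= D ^+ 3 by rewrite ler_pXn2r ?nnegrE //; lra.
  lra.
have Q0 : 0 < N * D by rewrite mulr_gt0 //; lra.
(* The four products contribute at most 4/100, 1/10, 4/10 and 1/100 of [(N * D) ^+ 2]. *)
have X : (N * lam + D) * (4 * (N * lam * D) + D ^+ 3) <=
    3 / 5 * (N * D) ^+ 2.
  have h1 : N ^+ 2 * D * lam ^+ 2 <= N ^+ 2 * D * (D / 100).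
    by rewrite ler_wpM2l // mulr_ge0 ?sqr_ge0 //; lra.
  have h2 : N * D ^+ 2 * (lam * D) <= N * D ^+ 2 * (N / 10).
    by rewrite ler_wpM2l // mulr_ge0 ?sqr_ge0 //; lra.
  have h3 : N * D * (lam * D) <= N * D * (N / 10) by rewrite ler_wpM2l // ltW.
  have h4 : N ^+ 2 * D * 1 <= N ^+ 2 * D * D.
    by rewrite ler_wpM2l // mulr_ge0 ?sqr_ge0 //; lra.
  have h5 : D ^+ 2 * D ^+ 2 <= (N / 10) ^+ 2 * D ^+ 2.
    by rewrite ler_wpM2r ?sqr_ge0 // ler_pXn2r ?nnegrE //; lra.
  have h6 : 0 < N ^+ 2 * D ^+ 2 by rewrite mulr_gt0 ?exprn_gt0 //; lra.
  lra.
apply: le_lt_trans (_ : 3 / 5 * (N * D) ^+ 2 < _).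
  apply: le_trans X; apply: ler_pM => //.
    by have : 0 <= (N - 1) * lam; [rewrite mulr_ge0 //|]; lra.
  by rewrite !addr_ge0 ?mulr_ge0 ?exprn_ge0 //; lra.
apply: lt_le_trans (_ : (9 / 10 * (N * D)) ^+ 2 <= _); last first.
  by rewrite ler_pXn2r ?nnegrE //; lra.
have : 0 < (N * D) ^+ 2 by rewrite exprn_gt0.
lra.
Qed.

(** Here [t] is the cube root of d. The hypothesis [1 <= a * t] absorbs [p] into [lam = a * t], so
    [(lam + p) ^+ 3] is at most [8 * a ^+ 3 * d < eps * d], too small for the cube inequality. *)
Lemma dense_lambda2_gt (R : realType) (V : finType) (G : sgraph V) (d : nat)
    (eps a t : R) : (1 <= d)%N -> regular G d -> 0 < eps ->
  0 < a -> a < 1 -> 8 * a ^+ 3 < eps -> t ^+ 3 = d%:R -> 1 <= a * t ->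
  d%:R <= (1 / 2 - eps) * #|V|%:R -> a * t < lambda2 R G.
Proof.
move=> d1 regG eps0 a0 a1 aeps tD at1 deps; rewrite ltNge; apply/negP => l2.
have D1 : 1 <= d%:R :> R by rewrite ler1n.
have V0 : (0 < #|V|)%N.
  by rewrite lt0n; apply/negP => /eqP V0; move: deps; rewrite V0; lra.
have N0 : 0 < #|V|%:R :> R by rewrite ltr0n.
have t1 : 1 < t by nra.
have lamD : a * t < d%:R.
  rewrite -tD; have h : a * t < t by nra.
  have t2 : 1 < t ^+ 2 by nra.
  by apply: lt_trans h _; rewrite exprSr; nra.
have := regular_cube_ineq regG V0 l2 lamD.
have : (d%:R - a * t) / #|V|%:R * #|V|%:R = d%:R - a * t.
  by rewrite divfK // gt_eqF.
have : 0 <= (d%:R - a * t) / #|V|%:R.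
  by rewrite mulr_ge0 ?invr_ge0 ?(ltW N0) // subr_ge0 ltW.
have : (d%:R - a * t) / #|V|%:R <= 1 / 2 - eps by rewrite ler_pdivrMr //; lra.
move: ((d%:R - a * t) / #|V|%:R : R) => p pe p0 pN; apply/negP; rewrite -ltNge.
move: (#|V|%:R : R) (d%:R : R) tD D1 N0 deps lamD pN => N D tD D1 N0 deps lamD pN.
have A : (a * t + p) ^+ 3 <= 8 * a ^+ 3 * D.
  have -> : 8 * a ^+ 3 * D = (2 * (a * t)) ^+ 3 by rewrite -tD; ring.
  by rewrite ler_pXn2r ?nnegrE //; lra.
have B : 8 * a ^+ 3 * D < eps * D by rewrite ltr_pM2r //; lra.
(* Replacing [N * p] by [D] collapses the remaining terms of the cube inequality to
   [- D * (1 - p) * (1 - 2 * p)]. *)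
have E : N * p * p ^+ 2 <= D * p ^+ 2.
  by rewrite ler_wpM2r ?sqr_ge0 // mulrC pN; lra.
have p3 : 0 <= p ^+ 3 by rewrite exprn_ge0.
(* Since [p <= 1 / 2 - eps], the factors are at least 1/2 and [2 * eps]. *)
have F : eps <= (1 - p) * (1 - 2 * p) by nra.
have H : eps * D <= (1 - p) * (1 - 2 * p) * D by rewrite ler_wpM2r //; lra.
lra.
Qed.

(** * Rational exponents and the three ranges of the degree *)

Lemma powR_frac (R : realType) (x : R) (p q : nat) : 0 <= x -> (0 < q)%N ->
  (x `^ (p%:R / q%:R)) ^+ q = x ^+ p.
Proof.
move=> x0 q0; rewrite -powR_mulrn ?powR_ge0 // -powRrM divfK ?powR_mulrn //.
by rewrite pnatr_eq0 -lt0n.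
Qed.

Lemma ler_powR_frac (R : realType) (x y : R) (p q : nat) :
  0 <= x -> 0 <= y -> (0 < q)%N ->
  (y <= x `^ (p%:R / q%:R)) = (y ^+ q <= x ^+ p).
Proof.
by move=> x0 y0 q0; rewrite -(powR_frac p x0 q0) ler_pXn2r ?nnegrE ?powR_ge0.
Qed.

Lemma powR_frac_ler (R : realType) (x y : R) (p q : nat) :
  0 <= x -> 0 <= y -> (0 < q)%N ->
  (x `^ (p%:R / q%:R) <= y) = (x ^+ p <= y ^+ q).
Proof.
by move=> x0 y0 q0; rewrite -(powR_frac p x0 q0) ler_pXn2r ?nnegrE ?powR_ge0.
Qed.

Theorem theorem1p6 (R : realType) :
  exists c : R, 0 < c /\
  forall eps : R, 0 < eps ->
  exists c1 : R, 0 < c1 /\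
  exists n0 : nat, forall n : nat, (n0 <= n)%N ->
  forall (V : finType) (G : sgraph V) (d : nat),
    #|V| = n -> (1 <= d)%N -> regular G d ->
  [/\ (d%:R <= n%:R `^ (2 / 3) :> R ->
         c * d%:R `^ (1 / 2) < lambda2 R G),
      (n%:R `^ (2 / 3) <= d%:R :> R -> d%:R <= n%:R `^ (3 / 4) :> R ->
         c * (n%:R / d%:R) < lambda2 R G)
    & (n%:R `^ (3 / 4) <= d%:R :> R -> d%:R <= (1 / 2 - eps) * n%:R ->
         c1 * d%:R `^ (1 / 3) < lambda2 R G)].
Proof.
(* With this constant, [lam ^+ 2] is exactly d/100 in the first range and [lam * d] is exactly n/10
   in the second. *)
exists (1 / 10); split; first by lra.
(* [a] is at most 1/4 and at most eps/4, so [8 * a ^+ 3] is at most eps/8. *)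
move=> eps eps0; pose a := Num.min 1 eps / 4.
have m0 : 0 < Num.min 1 eps by rewrite lt_min ltr01.
have a0 : 0 < a by rewrite /a; lra.
have [m_ge0 a_ge0] := (ltW m0, ltW a0).
have m1 : Num.min 1 eps <= 1 by rewrite ge_min lexx.
have m2 : Num.min 1 eps <= eps by rewrite ge_min lexx orbT.
have a1 : a <= 1 / 4 by rewrite /a; lra.
have aeps : 8 * a ^+ 3 < eps.
  have a4 : a <= eps / 4 by rewrite /a; lra.
  have : a * a ^+ 2 <= eps / 4 * (1 / 4) ^+ 2.
    by rewrite ler_pM ?sqr_ge0 ?ler_pXn2r ?nnegrE //; lra.
  lra.
(* The second bound serves the dense range: [a ^- 4 <= n] and [n ^+ 3 <= d ^+ 4] give [a ^- 3 <= d],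
   that is, [a] times the cube root of d is at least 1. *)
exists a; split=> //; exists (maxn (Num.bound (10 ^+ 4 : R)) (Num.bound (a ^- 4))).
move=> n; rewrite geq_max => /andP[nb na] V G d Vn d1 regG; subst n.
have D1 : 1 <= d%:R :> R by rewrite ler1n.
have N4 : 10 ^+ 4 <= #|V|%:R :> R.
  apply: ltW; apply: lt_le_trans (_ : (Num.bound (10 ^+ 4 : R))%:R <= _).
    by rewrite archi_boundP // exprn_ge0.
  by rewrite ler_nat.
have N1 : 1 <= #|V|%:R :> R by apply: le_trans N4; rewrite exprn_ege1 // ler1n.
have [D0 N0] : 0 <= d%:R :> R /\ 0 <= #|V|%:R :> R by [].
split.
- rewrite (ler_powR_frac 2) // => d3; apply: (sparse_lambda2_gt N4 d1 regG).
  + by rewrite mulr_ge0 ?powR_ge0 //; lra.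
  + by rewrite exprMn (powR_frac 1) // expr1; lra.
  + have : d%:R `^ (1 / 2) * d%:R <= #|V|%:R :> R.
      rewrite -(@ler_pXn2r _ 2) ?nnegrE ?mulr_ge0 ?powR_ge0 //.
      by rewrite exprMn (powR_frac 1) // expr1 -exprS.
    by lra.
  + rewrite exprSr [leRHS]exprSr ler_pM ?exprn_ge0 //.
    rewrite -(@ler_pXn2r _ 3) ?nnegrE //; apply: le_trans d3 _.
    by rewrite ler_weXn2l.
- rewrite (powR_frac_ler 2) // (ler_powR_frac 3) // => d3 d4.
  apply: (sparse_lambda2_gt N4 d1 regG) => //.
  + rewrite exprMn expr_div_n.
    (* Equivalent to [n ^+ 2 <= d ^+ 3], the lower end of this range. *)
    suff : #|V|%:R ^+ 2 / d%:R ^+ 2 <= d%:R :> R by lra.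
    by rewrite ler_pdivrMr ?exprn_gt0 -?exprS //; lra.
  + by rewrite -mulrA divfK ?gt_eqF //; lra.
- rewrite (powR_frac_ler 3) // => d4 deps.
  apply: (@dense_lambda2_gt R V G d eps a) => //; first by lra.
    by rewrite (powR_frac 1).
  rewrite mulrC -ler_pdivrMr // (ler_powR_frac 1) // ?divr_ge0 //.
  have aN : a ^- 4 <= #|V|%:R.
    apply: ltW; apply: lt_le_trans (_ : (Num.bound (a ^- 4))%:R <= _).
      by rewrite archi_boundP // invr_ge0 exprn_ge0.
    by rewrite ler_nat.
  rewrite expr1 -(@ler_pXn2r _ 4) ?nnegrE ?exprn_ge0 ?divr_ge0 //.
  apply: le_trans d4; rewrite div1r -exprM (exprM _ 4 3) exprVn.
  by rewrite ler_pXn2r ?nnegrE ?invr_ge0 ?exprn_ge0.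
Qed.
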